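(* Let $C,C_1,C_2,D$ be at most countable sets and let $$u\in\Delta\bigl(K\times(C\times C_1\times C_2)\times D\bigr),\quad v=\mathrm{marg}_{K\times(C\times C_1)\times D}u,\quad u'=\mathrm{marg}_{K\times(C\times C_2)\times D}u,\quad v'=\mathrm{marg}_{K\times C\times D}u.$$ Suppose that, under $u$, $c_1$ is conditionally independent from $(c,c_2,d)$ given $k$. Then $$d(u',v')\ge d(u,v).$$
   Context: $K$ is a finite set with $|K|\ge2$. An information structure is a probability on $K\times S_1\times S_2$ with $S_1,S_2$ at most countable, where $k\in K$ is the state and $S_i$ is the set of signals of player $i$. In $u$, player 1's signal is $(c,c_1,c_2)\in C\times C_1\times C_2$ and player 2's signal is $d\in D$; in $v$, $u'$, $v'$ player 1's signal is respectively $(c,c_1)$, $(c,c_2)$, $c$ and player 2's signal is $d$. $\mathrm{marg}$ denotes the marginal distribution. A payoff function is a map $g:K\times I\times J\to[-1,1]$ with $I,J$ nonempty finite sets; $\mathcal{G}$ is the set of all payoff functions. In the zero-sum Bayesian game $\Gamma(u,g)$, $(k,s_1,s_2)$ is drawn from $u$, player $i$ learns $s_i$, they simultaneously choose $i\in I$ and $j\in J$, and player 1 (the maximizer) receives $g(k,i,j)$ from player 2; $\mathrm{val}(u,g)$ is its value in mixed strategies. The value-based distance is $d(u,v)=\sup_{g\in\mathcal{G}}|\mathrm{val}(u,g)-\mathrm{val}(v,g)|$. *)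

(* Defs.v *)
(* MathComp-Analysis: reals are an abstract [R : realType]. *)
From mathcomp Require Import all_boot all_order all_algebra.
From mathcomp Require Import all_classical all_reals all_analysis.

Set Implicit Arguments.
Unset Strict Implicit.
Unset Printing Implicit Defensive.

Import Order.TTheory GRing.Theory Num.Theory.
Local Open Scope classical_set_scope.
Local Open Scope ring_scope.

Section Distributions.
Variable R : realType.

(* [dist R T] is Delta(T); a [countType] is at most countable (finite types
   are count types, and the empty type carries no distribution). *)
Record dist (T : countType) := Dist {
  pmf :> T -> R ;
  pmf_ge0 : forall x, 0 <= pmf x ;
  pmf_sum1 : \esum_(x in [set: T]) (pmf x)%:E = 1%E }.

Definition Pr (T : countType) (u : dist T) (A : set T) : R :=
  fine (\esum_(x in A) (u x)%:E).

Definition cPr (T : countType) (u : dist T) (A B : set T) : R :=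
  Pr u (A `&` B) / Pr u B.

(* [\esum] is only meaningful for nonnegative families, whence the split into
   positive and negative parts. *)
Definition expect (T : countType) (u : dist T) (f : T -> R) : R :=
  let F x := (u x * f x)%:E in
  fine (\esum_(x in [set: T]) F^\+%E x - \esum_(x in [set: T]) F^\-%E x)%E.

Definition cond_indep (T X Y Z : countType) (u : dist T)
    (x : T -> X) (y : T -> Y) (z : T -> Z) : Prop :=
  forall c, 0 < Pr u (z @^-1` [set c]) ->
  forall a b,
    cPr u (x @^-1` [set a] `&` y @^-1` [set b]) (z @^-1` [set c]) =
    cPr u (x @^-1` [set a]) (z @^-1` [set c]) *
    cPr u (y @^-1` [set b]) (z @^-1` [set c]).

Section Marginal.
Variables (T U : countType) (f : T -> U) (u : dist T).

Let p (y : U) : R := Pr u (f @^-1` [set y]).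

Let p_ge0 y : 0 <= p y.
Proof.
by apply/fine_ge0/esum_ge0 => x _; rewrite lee_fin pmf_ge0.
Qed.

Let p_sum1 : \esum_(y in [set: U]) (p y)%:E = 1%E.
Proof.
have fin y : (\esum_(x in f @^-1` [set y]) (u x)%:E)%E \is a fin_num.
  rewrite ge0_fin_numE; last by apply: esum_ge0 => x _; rewrite lee_fin pmf_ge0.
  apply: (@le_lt_trans _ _ 1%E); last exact: ltry.
  rewrite -(pmf_sum1 u) [leLHS]esum_mkcond; apply: le_esum => x _.
  by case: ifP => // _; rewrite lee_fin pmf_ge0.
under eq_esum do rewrite /p /Pr fineK //.
rewrite esum_esum; last by move=> y x; rewrite lee_fin pmf_ge0.
rewrite -(pmf_sum1 u) (reindex_esum [set: T] _ (fun x => (f x, x))) //.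
split => [x _ //|x y _ _ [] //|[y x] [_ /= <-]].
by exists x.
Qed.

(* Law of [f] under [u]; with [f] a coordinate projection, a marginal. *)
Definition marg : dist U := Dist p_ge0 p_sum1.

End Marginal.
End Distributions.

Section Games.
Variables (R : realType) (K : finType).

Record payoff := Payoff {
  act1 : finType ;
  act2 : finType ;
  act1_gt0 : (0 < #|act1|)%N ;
  act2_gt0 : (0 < #|act2|)%N ;
  pay :> K -> act1 -> act2 -> R ;
  pay_bounded : forall k i j, -1 <= pay k i j <= 1 }.

Section Value.
Variables (S1 S2 : countType) (u : dist R (K * S1 * S2)%type) (g : payoff).

(* Randomization is carried out after the signal is received (behavior
   strategies). *)
Definition strategy1 := S1 -> dist R (act1 g).
Definition strategy2 := S2 -> dist R (act2 g).

Definition expected_payoff (s : strategy1) (t : strategy2) : R :=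
  expect u (fun '(k, s1, s2) =>
    \sum_(i : act1 g) \sum_(j : act2 g) s s1 i * t s2 j * g k i j).

Definition maxmin : R :=
  sup [set inf [set expected_payoff s t | t in [set: strategy2]]
      | s in [set: strategy1]].

Definition minmax : R :=
  inf [set sup [set expected_payoff s t | s in [set: strategy1]]
      | t in [set: strategy2]].

(* The value is the common value of maxmin and minmax, which exists by the
   minimax theorem; 0 is an unused default. *)
Definition game_value : R := xget 0 [set w | w = maxmin /\ w = minmax].

End Value.

(* All values lie in [-1, 1], so this supremum is over a bounded set. It is
   not written as an image because [set payoff] is a universe inconsistency. *)
Definition vdist (S1 S2 T1 T2 : countType)
    (u : dist R (K * S1 * S2)%type) (v : dist R (K * T1 * T2)%type) : R :=
  sup [set r | exists g : payoff,
    r = `|game_value u g - game_value v g|].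

End Games.

(* Main.v *)
Require Import Defs.
From mathcomp Require Import all_boot all_order all_algebra.
From mathcomp Require Import all_classical all_reals all_analysis.
From mathcomp Require Import ring lra.

Import Order.TTheory GRing.Theory Num.Theory.
Local Open Scope classical_set_scope.
Local Open Scope ring_scope.

(** The extra signal [c1] can be absorbed into the payoff function.  Given the
state [k], the law of [c1] is [P(c1 | k)] whatever the other signals are, so
player 1 loses nothing by choosing a plan [a : C1 -> actions] before seeing
[c1] and letting the game average over [c1]: the payoff
  [g'(k, a, j) = \sum_c1 P(c1 | k) * g(k, a(c1), j)]
turns the game [g] played under [u] into the game [g'] played under [u'], and
the same [g'] turns [g] under [v] into [g'] under [v'].  Every value gap between
[u] and [v] is thus a value gap between [u'] and [v'].

Two points need work.  A payoff function must have finitely many actions, so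
plans are only defined on a finite set [F] of values of [c1], and the values of
the two games then differ by at most the probability that [c1] is outside [F]
([plan_game_value]).  The comparison maps strategies in both directions, by the
usual equivalence between behavior strategies (an independent draw for each
[c1], [product_dist]) and mixed plans (whose marginals are behavior strategies,
[ffun_marginal_dist]).

Since the comparison is only approximate, it controls [maxmin] but not an exact
equality [maxmin = minmax], and the value has to be known to exist.  The minimax
theorem for countably many signals ([minimax]) is proved without compactness, by
regret matching: player 1 runs the algorithm separately at each of its signals,
player 2 answers each stage with an almost best reply, and the time average of
those replies is almost optimal.  The regret at a signal is bounded by a
vanishing multiple of the mass of that signal, so the bounds add up over all
signals.

Expectations of bounded functions under countable laws are handled by
linearity, monotonicity, and truncation to finitely many values of a random
variable ([expect_truncate]), which gives the tower rule and the change of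
variables without any further manipulation of infinite sums. *)

(** * Expectation of bounded functions under a countable law *)

Section Expectation.
Set Implicit Arguments.
Unset Strict Implicit.
Variable R : realType.

Definition bdd (T : Type) (f : T -> R) := exists M : R, forall x, `|f x| <= M.

Lemma bdd_cst (T : Type) (c : R) : bdd (fun _ : T => c).
Proof. by exists `|c|. Qed.

Lemma bddD (T : Type) (f g : T -> R) : bdd f -> bdd g ->
  bdd (fun x => f x + g x).
Proof.
move=> [M fM] [N gN]; exists (M + N) => x.
by rewrite (le_trans (ler_normD _ _))// lerD.
Qed.

Lemma bddN (T : Type) (f : T -> R) : bdd f -> bdd (fun x => - f x).
Proof. by move=> [M fM]; exists M => x; rewrite normrN. Qed.

Lemma bddB (T : Type) (f g : T -> R) : bdd f -> bdd g ->
  bdd (fun x => f x - g x).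
Proof. by move=> bf bg; exact: bddD bf (bddN bg). Qed.

Lemma bddM (T : Type) (f g : T -> R) : bdd f -> bdd g ->
  bdd (fun x => f x * g x).
Proof.
move=> [M fM] [N gN]; exists (M * N) => x.
by rewrite normrM ler_pM.
Qed.

Lemma bdd_bool (T : Type) (b : T -> bool) : bdd (fun x => (b x)%:R).
Proof. by exists 1 => x; case: (b x); rewrite ?normr1 ?normr0. Qed.

Lemma bdd_sum (T I : Type) (r : seq I) (P : pred I) (F : I -> T -> R) :
  (forall i, P i -> bdd (F i)) -> bdd (fun x => \sum_(i <- r | P i) F i x).
Proof.
move=> bF; elim: r => [|i r [M ih]].
  by exists 0 => x; rewrite big_nil normr0.
case Pi : (P i); last first.
  by exists M => x; rewrite big_cons Pi.
have [N FN] := bF i Pi.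
exists (N + M) => x; rewrite big_cons Pi.
by rewrite (le_trans (ler_normD _ _))// lerD.
Qed.

Lemma esumZl (T : choiceType) (c : R) (a : T -> R) : 0 <= c ->
  (forall x, 0 <= a x) ->
  \esum_(x in [set: T]) (c * a x)%:E =
  (c%:E * \esum_(x in [set: T]) (a x)%:E)%E.
Proof.
move=> c0 a0; rewrite /esum -ereal_supZl//; last first.
  by apply/set0P; exists (\sum_(x \in set0) (a x)%:E)%E;
     exists set0 => //; split.
congr ereal_sup; rewrite image_comp; apply: eq_imagel => A [finA _] /=.
by rewrite ge0_mule_fsumr// => x; rewrite lee_fin.
Qed.

Lemma dist_inhabited (T : countType) (u : dist R T) : exists x : T, True.
Proof.
have [//|noT] := pselect (exists x : T, True).
have /esym/eqP := Defs.pmf_sum1 u; rewrite esum1 ?onee_eq0// => x.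
by case: noT; exists x.
Qed.

Section OneLaw.
Variables (T : countType) (u : dist R T).
Implicit Types f g : T -> R.

(* [expect] splits [f] into signed parts, which is awkward for linearity;
   adding a bound [M] to [f] reduces everything to sums of nonnegative terms. *)
Let mean f : \bar R := \esum_(x in [set: T]) (u x * f x)%:E.

Let mean_cst (c : R) : 0 <= c -> mean (fun _ => c) = c%:E.
Proof.
move=> c0; rewrite /mean -[RHS]mule1 -(Defs.pmf_sum1 u) -esumZl//.
  by apply: eq_esum => x _; rewrite mulrC.
exact: Defs.pmf_ge0.
Qed.

Let mean_fin f (M : R) : (forall x, 0 <= f x <= M) -> mean f \is a fin_num.
Proof.
move=> fM; rewrite ge0_fin_numE; last first.
  apply: esum_ge0 => x _; rewrite lee_fin mulr_ge0 ?Defs.pmf_ge0//.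
  by case/andP: (fM x).
have [x0 _] := dist_inhabited u.
have M0 : 0 <= M by case/andP: (fM x0); exact: le_trans.
apply: (@le_lt_trans _ _ M%:E); last exact: ltry.
rewrite -[leRHS]mean_cst//; apply: le_esum => x _.
by rewrite lee_fin ler_wpM2l ?Defs.pmf_ge0//; case/andP: (fM x).
Qed.

Let expectE f (M : R) : (forall x, `|f x| <= M) ->
  expect u f = fine (mean (fun x => f x + M)) - M.
Proof.
move=> fM.
have [x0 _] := dist_inhabited u.
have M0 : 0 <= M by rewrite (le_trans _ (fM x0)).
have fM0 x : 0 <= f x + M <= M + M.
  by move: (fM x); rewrite ler_norml => /andP[] *; apply/andP; split; lra.
rewrite /expect.
have -> : (fun x : T => (u x * f x)%:E) =
   ((fun x => (u x * (f x + M))%:E) \- (fun x => (u x * M)%:E))%E.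
  by apply/funext => x /=; rewrite -EFinB -mulrBr addrK.
have summ g N : (forall x, 0 <= g x <= N) ->
    summable [set: T] (fun x => (u x * g x)%:E).
  move=> gN; rewrite summableE.
  suff -> : \esum_(x in [set: T]) `|(u x * g x)%:E|%E = mean g.
    exact: mean_fin gN.
  apply: eq_esum => x _; rewrite abse_EFin ger0_norm//.
  by rewrite mulr_ge0 ?Defs.pmf_ge0//; case/andP: (gN x).
rewrite esumB.
- rewrite -/(mean (fun x => f x + M)) -/(mean (fun=> M)) mean_cst//.
  by rewrite fineB// (mean_fin fM0).
- exact: summ fM0.
- by apply: (@summ _ M) => x; rewrite M0 lexx.
- move=> x _; rewrite lee_fin mulr_ge0 ?Defs.pmf_ge0//.
  by case/andP: (fM0 x).
- by move=> x _; rewrite lee_fin mulr_ge0 ?Defs.pmf_ge0.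
Qed.

Let expect_ge0E f (M : R) : (forall x, 0 <= f x <= M) ->
  expect u f = fine (mean f).
Proof.
move=> fM.
have [x0 _] := dist_inhabited u.
have M0 : 0 <= M by case/andP: (fM x0); exact: le_trans.
have f0 x : 0 <= f x by case/andP: (fM x).
have fM' x : `|f x| <= M by rewrite ger0_norm//; case/andP: (fM x).
rewrite (expectE fM').
have -> : mean (fun x => f x + M) = (mean f + mean (fun => M))%E.
  rewrite -esumD.
  - by apply: eq_esum => x _; rewrite mulrDr EFinD.
  - by move=> x _; rewrite lee_fin mulr_ge0 ?Defs.pmf_ge0.
  - by move=> x _; rewrite lee_fin mulr_ge0 ?Defs.pmf_ge0.
by rewrite mean_cst// fineD ?(mean_fin fM)//= addrK.
Qed.

Lemma expectD f g : bdd f -> bdd g ->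
  expect u (fun x => f x + g x) = expect u f + expect u g.
Proof.
move=> [M fM] [N gN].
have fgMN x : `|f x + g x| <= M + N.
  by rewrite (le_trans (ler_normD _ _))// lerD.
have fM0 x : 0 <= f x + M <= M + M.
  by move: (fM x); rewrite ler_norml => /andP[] *; apply/andP; split; lra.
have gN0 x : 0 <= g x + N <= N + N.
  by move: (gN x); rewrite ler_norml => /andP[] *; apply/andP; split; lra.
rewrite (expectE fM) (expectE gN) (expectE fgMN).
have -> : mean (fun x => f x + g x + (M + N)) =
    (mean (fun x => (f x + M)%R) + mean (fun x => (g x + N)%R))%E.
  rewrite -esumD.
  - by apply: eq_esum => x _; rewrite -EFinD; congr EFin; ring.
  - move=> x _; rewrite lee_fin mulr_ge0 ?Defs.pmf_ge0//; by case/andP: (fM0 x).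
  - move=> x _; rewrite lee_fin mulr_ge0 ?Defs.pmf_ge0//; by case/andP: (gN0 x).
by rewrite fineD ?(mean_fin fM0) ?(mean_fin gN0)//; ring.
Qed.

Lemma expect_cst (c : R) : expect u (fun _ => c) = c.
Proof.
have cM (x : T) : `|c| <= `|c| by [].
rewrite (expectE cM) mean_cst /= ?addrK//.
by rewrite -lerBlDr sub0r lerNl -normrN ler_norm.
Qed.

Lemma expectN f : bdd f -> expect u (fun x => - f x) = - expect u f.
Proof.
move=> bf; apply/eqP; rewrite -addr_eq0 -expectD//; last exact: bddN.
rewrite -[X in _ == X](expect_cst 0); apply/eqP; congr expect.
by apply/funext => x; rewrite addNr.
Qed.

Lemma expectB f g : bdd f -> bdd g ->
  expect u (fun x => f x - g x) = expect u f - expect u g.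
Proof. by move=> bf bg; rewrite expectD ?expectN//; exact: bddN. Qed.

Lemma expect_ge0 f : bdd f -> (forall x, 0 <= f x) -> 0 <= expect u f.
Proof.
move=> [M fM] f0; rewrite (@expect_ge0E _ M) => [|x].
  apply/fine_ge0/esum_ge0 => x _.
  by rewrite lee_fin mulr_ge0 ?Defs.pmf_ge0.
by rewrite f0 (le_trans (ler_norm _)).
Qed.

Lemma le_expect f g : bdd f -> bdd g -> (forall x, f x <= g x) ->
  expect u f <= expect u g.
Proof.
move=> bf bg fg; rewrite -subr_ge0 -expectB//.
by apply: expect_ge0; [exact: bddB|move=> x; rewrite subr_ge0].
Qed.

Lemma expectZ (c : R) f : bdd f -> expect u (fun x => c * f x) = c * expect u f.
Proof.
wlog f0 : f / forall x, 0 <= f x => [hw bf|].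
  have [M fM] := bf.
  have -> : expect u f = expect u (fun x => f x + M) - M.
    by rewrite expectD ?expect_cst ?addrK//; exact: bdd_cst.
  rewrite mulrBr -hw; last 2 first.
  - by move=> x; move: (fM x); rewrite ler_norml => /andP[] *; lra.
  - by apply: bddD => //; exact: bdd_cst.
  under [in RHS]eq_fun do rewrite mulrDr.
  rewrite expectD ?expect_cst ?addrK//.
    by apply: bddM => //; exact: bdd_cst.
  exact: bdd_cst.
wlog c0 : c / 0 <= c => [hw bf|].
  have [c0|c0] := leP 0 c; first exact: hw.
  rewrite -[LHS]opprK -expectN; last by apply: bddM => //; exact: bdd_cst.
  under eq_fun do rewrite -mulNr.
  by rewrite hw// ?mulNr ?opprK// oppr_ge0 ltW.
move=> [M fM].
have f0M x : 0 <= f x <= M by rewrite f0 (le_trans (ler_norm _)).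
rewrite (expect_ge0E f0M) (@expect_ge0E _ (c * M)); last first.
  by move=> x; case/andP: (f0M x) => ? ?; rewrite mulr_ge0// ler_wpM2l.
have -> : mean (fun x => c * f x) = (c%:E * mean f)%E.
  rewrite -esumZl//; first by apply: eq_esum => x _; rewrite mulrCA.
  by move=> x; rewrite mulr_ge0 ?Defs.pmf_ge0.
by rewrite fineM// (mean_fin f0M).
Qed.

Lemma expect_sum (I : Type) (r : seq I) (P : pred I) (F : I -> T -> R) :
  (forall i, P i -> bdd (F i)) ->
  expect u (fun x => \sum_(i <- r | P i) F i x) =
  \sum_(i <- r | P i) expect u (F i).
Proof.
move=> bF; elim: r => [|i r ih].
  by under eq_fun do rewrite big_nil; rewrite expect_cst big_nil.
rewrite big_cons; under eq_fun do rewrite big_cons.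
case: ifP => // Pi; rewrite -ih expectD//; first exact: bF.
exact: bdd_sum.
Qed.

Lemma norm_expect_le f g : bdd f -> bdd g -> (forall x, `|f x| <= g x) ->
  `|expect u f| <= expect u g.
Proof.
move=> bf bg fg; rewrite ler_norml -expectN//; apply/andP; split.
- apply: le_expect => //; first exact: bddN.
  by move=> x; move: (fg x); rewrite ler_norml => /andP[].
- apply: le_expect => //.
  by move=> x; move: (fg x); rewrite ler_norml => /andP[].
Qed.

Lemma norm_expect_le_cst f (c : R) : (forall x, `|f x| <= c) ->
  `|expect u f| <= c.
Proof.
move=> fc; rewrite -[leRHS]expect_cst; apply: norm_expect_le => //.
- by exists c.
- exact: bdd_cst.
Qed.

(** The hypothesis allows the indicator to be a decidable description of
[A], so that probabilities become expectations of boolean expressions. *)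
Lemma Pr_expect (A : set T) (b : T -> bool) : (forall x, A x <-> b x) ->
  Pr u A = expect u (fun x => (b x)%:R).
Proof.
move=> Ab; rewrite (@expect_ge0E _ 1).
  rewrite /Pr esum_mkcond; congr fine; apply: eq_esum => x _.
  have [xA|xA] := boolP (x \in A).
    by move/set_mem/Ab : xA => ->; rewrite mulr1.
  case bx : (b x); last by rewrite mulr0.
  by move: xA; rewrite notin_setE => -[]; apply/Ab.
by move=> x; case: (b x); rewrite ?lexx ?ler01.
Qed.

(** A countable law puts almost all of its mass on finitely many points, hence
on finitely many values of any random variable. *)
Lemma expect_tail (Y : choiceType) (phi : T -> Y) (e : R) : 0 < e ->
  exists F : seq Y, expect u (fun x => (phi x \notin F)%:R) <= e.
Proof.
move=> e0.
have fin1 : \esum_(x in [set: T]) (u x)%:E \is a fin_num.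
  by rewrite Defs.pmf_sum1.
have [_ [A [finA _] <-]] := ub_ereal_sup_adherent e0 fin1.
rewrite -/(esum _ _) Defs.pmf_sum1 => lA.
pose X : seq T := finmap.enum_fset (fset_set A).
have memX x : (x \in X) = (x \in A) by exact: in_fset_set.
exists (map phi X).
have {lA} : 1 - e < Pr u A.
  rewrite /Pr esum_fset//; last by move=> x _; rewrite lee_fin Defs.pmf_ge0.
  move: lA; rewrite fsbig_finite//= sumEFin -EFinB lte_fin.
  by [].
rewrite (@Pr_expect _ (fun x => x \in X)); last first.
  by move=> x; rewrite memX inE.
move=> lA.
have bb (b : T -> bool) := bdd_bool b.
apply: (@le_trans _ _ (expect u (fun x => 1 - (x \in X)%:R))).
  apply: le_expect => //.
    by apply: bddB => //; exact: bdd_cst.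
  move=> x; have [xA|xA] := boolP (x \in X); last first.
    by rewrite subr0; case: (_ \notin _).
  by rewrite map_f//= subrr.
by rewrite expectB// ?expect_cst; [lra|exact: bdd_cst].
Qed.

(** This replaces every exchange of an infinite sum with an expectation: finitely
many values of [phi] are summed exactly, and the rest costs a tail probability. *)
Lemma expect_truncate (Y : choiceType) (phi : T -> Y) (F : seq Y) f (M : R) :
  (forall x, `|f x| <= M) ->
  `|expect u f - \sum_(y <- undup F) expect u (fun x => (phi x == y)%:R * f x)|
    <= M * expect u (fun x => (phi x \notin F)%:R).
Proof.
move=> fM; have bf : bdd f by exists M.
have bb (b : T -> bool) := bdd_bool b.
have bbf (b : T -> bool) : bdd (fun x => (b x)%:R * f x) by exact: bddM.
have -> : expect u f =
  expect u (fun x => (\sum_(y <- undup F) (phi x == y)%:R * f x) +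
     (phi x \notin F)%:R * f x).
  congr expect; apply/funext => x.
  have [xF|xF] := boolP (phi x \in F).
    rewrite mul0r addr0 (bigD1_seq (phi x)) ?undup_uniq ?mem_undup//=.
    rewrite eqxx mul1r.
    by rewrite big1 ?addr0// => y /negPf; rewrite eq_sym => ->; rewrite mul0r.
  rewrite mul1r big1_seq ?add0r// => y /=.
  rewrite mem_undup => yF.
  have [eqy|_] := eqVneq (phi x) y; last by rewrite mul0r.
  by rewrite eqy yF in xF.
rewrite expectD//; last by apply: bdd_sum.
rewrite expect_sum// addrAC subrr add0r -expectZ//.
apply: norm_expect_le => //; first by apply: bddM => //; exact: bdd_cst.
move=> x; case: (_ \notin _); rewrite ?mul0r ?mulr0 ?normr0//.
by rewrite mul1r mulr1.
Qed.

(** The form of [expect_tail] that matches the error of [expect_truncate];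
[`|M|] makes it usable for a bound [M] of unknown sign. *)
Lemma expect_tail_bound (Y : choiceType) (phi : T -> Y) (M e : R) : 0 < e ->
  exists F : seq Y, `|M| * expect u (fun x => (phi x \notin F)%:R) <= e.
Proof.
move=> e0; have M1 : 0 < `|M| + 1 by rewrite ltr_wpDl.
have [F hF] := expect_tail phi (divr_gt0 e0 M1).
exists F; rewrite ler_pdivlMr// in hF; apply: le_trans hF.
rewrite mulrDr mulr1 mulrC lerDl.
by apply: expect_ge0 => [|x]; [exact: bdd_bool|case: (_ \notin _)].
Qed.

(** The tower rule, in the form used here: it suffices to check the sign of an
expectation on each event [phi = y]. *)
Lemma tower_le0 (Y : choiceType) (phi : T -> Y) f : bdd f ->
  (forall y, expect u (fun x => (phi x == y)%:R * f x) <= 0) ->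
  expect u f <= 0.
Proof.
move=> [M fM] h; apply/ler_addgt0Pl => e e0; rewrite addr0.
have [F hF] := expect_tail_bound phi M e0.
have fM' x : `|f x| <= `|M| by rewrite (le_trans (fM x))// ler_norm.
have := expect_truncate phi F fM'.
move=> /(le_trans (ler_norm _))/le_trans/(_ hF); rewrite lerBlDr => /le_trans.
by apply; rewrite gerDl; apply: sumr_le0 => y _; exact: h.
Qed.

Lemma tower_eq0 (Y : choiceType) (phi : T -> Y) f : bdd f ->
  (forall y, expect u (fun x => (phi x == y)%:R * f x) = 0) ->
  expect u f = 0.
Proof.
move=> bf h; apply/eqP; rewrite eq_le; apply/andP; split.
  by apply: (@tower_le0 _ phi) => // y; rewrite h.
rewrite -oppr_le0 -expectN//.
apply: (@tower_le0 _ phi); first exact: bddN.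
move=> y; under eq_fun do rewrite mulrN.
by rewrite expectN ?h ?oppr0//; apply: bddM => //; exact: bdd_bool.
Qed.

End OneLaw.

Lemma expect_marg (T U : countType) (u : dist R T) (f : T -> U) (h : U -> R) :
  bdd h -> expect (marg f u) h = expect u (fun x => h (f x)).
Proof.
move=> bh; have [M hM0] := bh.
have atom (y : U) : expect (marg f u) (fun z => (z == y)%:R) =
    expect u (fun x => (f x == y)%:R).
  rewrite -(@Pr_expect _ _ [set y]); last by move=> z /=; split => [->|/eqP].
  rewrite /Pr esum_set1 ?lee_fin ?Defs.pmf_ge0//=.
  rewrite (Pr_expect u (b := fun x => f x == y))//.
  by move=> x /=; split => [->|/eqP].
have eqs (y z : U) : (z == y)%:R * h z = h y * (z == y)%:R.
  by have [->|] := eqVneq z y; rewrite ?mul0r ?mulr0 ?mul1r ?mulr1.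
(* Both sides agree on every atom, and truncating to finitely many atoms costs
   arbitrarily little under either law. *)
apply/eqP; rewrite -subr_eq0 -normr_le0; apply/ler_addgt0Pl => e e0.
rewrite addr0.
have e20 : 0 < e / 2 by rewrite divr_gt0.
have [F1 hF1] := expect_tail_bound (marg f u) id M e20.
have [F2 hF2] := expect_tail_bound u f M e20.
have bb (V : Type) (b : V -> bool) := bdd_bool b.
pose F := F1 ++ F2.
have hM y : `|h y| <= `|M| by rewrite (le_trans (hM0 y))// ler_norm.
have := expect_truncate (marg f u) id F hM.
have := expect_truncate u f F (fun x => hM (f x)).
have -> : \sum_(y <- undup F) expect u (fun x => (f x == y)%:R * h (f x)) =
    \sum_(y <- undup F) expect (marg f u) (fun z => (id z == y)%:R * h z).
  apply: eq_bigr => y _.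
  rewrite (_ : (fun z => _) = (fun z => h y * (z == y)%:R)); last first.
    exact/funext.
  rewrite (_ : (fun x => _) = (fun x => h y * (f x == y)%:R)); last first.
    by apply/funext => x.
  by rewrite !expectZ// atom.
set S := \sum_(y <- undup F) _ => h1 h2.
have {}h1 : `|expect u (fun x => h (f x)) - S| <= e / 2.
  apply: le_trans h1 (le_trans _ hF2); rewrite ler_wpM2l//.
  apply: le_expect => // x; rewrite /F mem_cat negb_or.
  by case: (_ \notin F1); rewrite //= ler0n.
have {}h2 : `|expect (marg f u) h - S| <= e / 2.
  apply: le_trans h2 (le_trans _ hF1); rewrite ler_wpM2l//.
  apply: le_expect => // x; rewrite /F mem_cat negb_or andbC.
  by case: (_ \notin F2); rewrite //= ler0n.
have -> : expect (marg f u) h - expect u (fun x => h (f x)) =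
  (expect (marg f u) h - S) - (expect u (fun x => h (f x)) - S) by ring.
by rewrite (le_trans (ler_normB _ _))// [leRHS]splitr lerD.
Qed.

End Expectation.

(** * Finite laws, regret matching and the minimax theorem *)

Section FiniteLaws.
Set Implicit Arguments.
Unset Strict Implicit.
Variables (R : realType) (A : finType).

Lemma esum_finType (a : A -> R) : (forall i, 0 <= a i) ->
  \esum_(i in [set: A]) (a i)%:E = (\sum_i a i)%:E.
Proof.
move=> a0; rewrite -sumEFin esum_fset//; last first.
  by move=> i _; rewrite lee_fin.
  exact: finite_finset.
rewrite [RHS]fsbig_seq ?index_enum_uniq//; apply: eq_fsbigl.
by apply/seteqP; split => i _ //=; exact: mem_index_enum.
Qed.

Lemma dist_sum (p : dist R A) : \sum_i p i = 1.
Proof.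
have := Defs.pmf_sum1 p; rewrite esum_finType => [[]//|].
exact: Defs.pmf_ge0.
Qed.

Lemma finite_dist (p : A -> R) : (forall i, 0 <= p i) -> \sum_i p i = 1 ->
  exists q : dist R A, forall i, q i = p i.
Proof.
move=> p0 p1.
have p1' : \esum_(i in [set: A]) (p i)%:E = 1%E by rewrite esum_finType// p1.
by exists (Dist p0 p1').
Qed.

Lemma dirac_dist (i0 : A) : exists q : dist R A, forall i, q i = (i == i0)%:R.
Proof.
apply: finite_dist => [i|]; first exact: ler0n.
by rewrite (bigD1 i0)//= eqxx big1 ?addr0// => i /negPf ->.
Qed.

Lemma dist_avg_le (p : dist R A) (a : A -> R) (c : R) :
  (forall i, a i <= c) -> \sum_i p i * a i <= c.
Proof.
move=> ac; rewrite -[leRHS]mul1r -(dist_sum p) mulr_suml.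
by apply: ler_sum => i _; rewrite ler_wpM2l ?Defs.pmf_ge0.
Qed.

Lemma dist_avg_norm_le (p : dist R A) (a : A -> R) (c : R) :
  (forall i, `|a i| <= c) -> `|\sum_i p i * a i| <= c.
Proof.
move=> ac; rewrite (le_trans (ler_norm_sum _ _ _))//.
under eq_bigr do rewrite normrM (ger0_norm (Defs.pmf_ge0 _ _)).
exact: dist_avg_le.
Qed.

End FiniteLaws.

Section RegretMatching.
Set Implicit Arguments.
Unset Strict Implicit.
Variables (R : realType) (A : finType).
Local Notation pos x := (Num.max 0 x).

(** Playing each action with probability proportional to its positive regret makes
the next regret vector orthogonal to the current positive regrets, whatever the
next payoffs [a] are. *)
Lemma regret_matching (r : A -> R) : (0 < #|A|)%N ->
  exists p : dist R A, forall a : A -> R,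
    \sum_i pos (r i) * (a i - \sum_j p j * a j) = 0.
Proof.
move=> /card_gt0P[i0 _].
have pos0 i : 0 <= pos (r i) by rewrite le_max lexx.
pose tot := \sum_i pos (r i).
have [tot0|tot0] := eqVneq tot 0.
  have [p _] := dirac_dist R i0; exists p => a; apply: big1 => i _.
  have /psumr_eq0P : \sum_i pos (r i) = 0 := tot0.
  by move=> -> //; rewrite mul0r.
have [i||p pE] := @finite_dist R A (fun i => pos (r i) / tot).
- by rewrite divr_ge0// sumr_ge0.
- by rewrite -mulr_suml divff.
exists p => a.
have -> : \sum_j p j * a j = (\sum_j pos (r j) * a j) / tot.
  by rewrite mulr_suml; apply: eq_bigr => j _; rewrite pE mulrAC.
under eq_bigr do rewrite mulrBr.
by rewrite sumrB -mulr_suml -/tot mulrCA divff// mulr1 subrr.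
Qed.

(** Because of the orthogonality, the potential [\sum_i pos (regret i) ^+ 2] can
only grow through the squares of the increments, hence linearly in time; the
regrets themselves are then of the order of the square root of time. *)
Lemma regret_bound (m : R) (a : nat -> A -> R) (p : nat -> dist R A) :
  (forall n i, `|a n i| <= m) ->
  let regret n i := \sum_(l < n) (a l i - \sum_j p l j * a l j) in
  (forall n (b : A -> R),
    \sum_i pos (regret n i) * (b i - \sum_j p n j * b j) = 0) ->
  forall n, \sum_i (pos (regret n i)) ^+ 2 <= n%:R * (#|A|%:R * (2 * m) ^+ 2).
Proof.
move=> am regret match0; elim=> [|n ih].
  by rewrite mul0r big1// => i _; rewrite /regret big_ord0 maxxx expr0n.
pose d i := a n i - \sum_j p n j * a n j.
have dm i : d i ^+ 2 <= (2 * m) ^+ 2.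
  have m0 : 0 <= m by exact: le_trans (am n i).
  rewrite -ler_sqrt ?sqr_ge0// !sqrtr_sqr [leRHS]ger0_norm ?mulr_ge0//.
  rewrite (le_trans (ler_normB _ _))// mulr2n mulrDl !mul1r lerD//.
  exact: dist_avg_norm_le.
(* [pos (x + y) <= `|pos x + y|], and the square of the latter is the bound. *)
have step i : pos (regret n.+1 i) ^+ 2 <=
    pos (regret n i) ^+ 2 + 2 * (pos (regret n i) * d i) + d i ^+ 2.
  rewrite /regret big_ord_recr/= -/(regret n i) -/(d i).
  move: (regret n i) (d i) => x y.
  rewrite !maxEle; case: (leP 0 x) => x0; case: (leP 0 (x + y)) => xy0; nra.
rewrite (le_trans (ler_sum _ (fun i _ => step i)))//.
rewrite !big_split/= -mulr_sumr match0 mulr0 addr0 -natr1 mulrDl mul1r lerD//.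
rewrite (le_trans (ler_sum _ (fun i _ => dm i)))//.
by rewrite sumr_const -[leLHS]mulr_natl lexx.
Qed.

End RegretMatching.

Section Minimax.
Set Implicit Arguments.
Unset Strict Implicit.
Variables (R : realType) (K : finType) (S1 S2 : countType).
Variables (u : dist R (K * S1 * S2)%type) (g : payoff R K).
Implicit Types (s : strategy1 S1 g) (t : strategy2 S2 g).

(** The payoff of each action of player 1 against [t], at a realization of the
state and signals: it makes the payoff an average over player 1's action. *)
Definition reply t (w : K * S1 * S2) (i : act1 g) : R :=
  \sum_j t w.2 j * g w.1.1 i j.

Lemma pay_norm_le (k : K) i j : `|g k i j| <= 1.
Proof. by rewrite ler_norml pay_bounded. Qed.

Lemma reply_norm_le t w i : `|reply t w i| <= 1.
Proof. by apply: dist_avg_norm_le => j; exact: pay_norm_le. Qed.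

Lemma expected_payoffE s t : expected_payoff u s t =
  expect u (fun w => \sum_i s w.1.2 i * reply t w i).
Proof.
congr expect; apply/funext => -[[k s1] s2] /=.
apply: eq_bigr => i _; rewrite mulr_sumr; apply: eq_bigr => j _ /=.
by rewrite mulrA.
Qed.

Lemma stage_norm_le s t w : `|\sum_i s w.1.2 i * reply t w i| <= 1.
Proof. by apply: dist_avg_norm_le => i; exact: reply_norm_le. Qed.

Lemma stage_bdd s t : bdd (fun w => \sum_i s w.1.2 i * reply t w i).
Proof. by exists 1 => w; exact: stage_norm_le. Qed.

Lemma payoff_norm_le s t : `|expected_payoff u s t| <= 1.
Proof.
by rewrite expected_payoffE; apply: norm_expect_le_cst => w; exact: stage_norm_le.
Qed.

Lemma strategy1_inhabited : exists s : strategy1 S1 g, True.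
Proof.
have /card_gt0P[i _] := act1_gt0 g.
by have [p _] := dirac_dist R i; exists (fun=> p).
Qed.

Lemma strategy2_inhabited : exists t : strategy2 S2 g, True.
Proof.
have /card_gt0P[i _] := act2_gt0 g.
by have [p _] := dirac_dist R i; exists (fun=> p).
Qed.

Lemma avg_strategy2 (N : nat) (ts : nat -> strategy2 S2 g) :
  exists t, forall s, expected_payoff u s t =
    N.+1%:R^-1 * \sum_(n < N.+1) expected_payoff u s (ts n).
Proof.
have /choice[t tE] (y : S2) : exists q : dist R (act2 g), forall j,
    q j = N.+1%:R^-1 * \sum_(n < N.+1) ts n y j.
  apply: finite_dist => [j|].
    rewrite mulr_ge0 ?invr_ge0 ?ler0n ?sumr_ge0// => n _.
    exact: Defs.pmf_ge0.
  rewrite -mulr_sumr exchange_big/=.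
  under eq_bigr do rewrite dist_sum.
  by rewrite sumr_const card_ord mulVf// pnatr_eq0.
exists t => s; rewrite expected_payoffE.
under [in RHS]eq_bigr do rewrite expected_payoffE.
rewrite -expect_sum; last by move=> n _; exact: stage_bdd.
rewrite -expectZ; last by apply: bdd_sum => n _; exact: stage_bdd.
congr expect; apply/funext => w.
rewrite exchange_big mulr_sumr; apply: eq_bigr => i _.
rewrite -mulr_sumr mulrCA; congr (_ * _).
rewrite /reply exchange_big mulr_sumr; apply: eq_bigr => j _.
by rewrite tE -mulrA mulr_suml.
Qed.

(* Weighting by the indicator of the signal, instead of conditioning on it,
   avoids dividing by the mass of a signal, which may vanish. *)
Let q t (y : S1) i : R := expect u (fun w => (w.1.2 == y)%:R * reply t w i).
Let mass (y : S1) : R := expect u (fun w => (w.1.2 == y)%:R).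

Let q_norm_le t y i : `|q t y i| <= mass y.
Proof.
have breply : bdd (fun w => reply t w i) by exists 1 => w; exact: reply_norm_le.
apply: norm_expect_le => [||w]; [|exact: bdd_bool|].
  by apply: bddM => //; exact: bdd_bool.
rewrite normrM (ger0_norm (ler0n _ _)) -[leRHS]mulr1 ler_wpM2l ?ler0n//.
exact: reply_norm_le.
Qed.

(** Player 1 runs regret matching at each signal [y] separately, with stage
payoffs [q t y] bounded by the mass of [y].  The regret after [N.+1] stages is at
most [N.+1 * e * mass y] for [N] large uniformly in [y], and these bounds sum to
[N.+1 * e].  The replies [br] may depend on the strategy just played. *)
Lemma no_regret (br : strategy1 S1 g -> strategy2 S2 g) (e : R) : 0 < e ->
  exists (N : nat) (ss : nat -> strategy1 S1 g), forall s,
    \sum_(n < N.+1) expected_payoff u s (br (ss n)) <=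
    \sum_(n < N.+1) expected_payoff u (ss n) (br (ss n)) + N.+1%:R * e.
Proof.
move=> e0.
have /choice[mt mtP] (r : act1 g -> R) := regret_matching r (act1_gt0 g).
pose next (r : S1 -> act1 g -> R) y i :=
  let s := fun y => mt (r y) in
  r y i + (q (br s) y i - \sum_j s y j * q (br s) y j).
pose rg n := iter n next (fun _ _ => 0).
pose ss n : strategy1 S1 g := fun y => mt (rg n y).
have rgE n y i : rg n y i =
    \sum_(l < n) (q (br (ss l)) y i - \sum_j ss l y j * q (br (ss l)) y j).
  by elim: n => [|n ih]; rewrite ?big_ord0// big_ord_recr/= -ih.
have [N hN] : exists N : nat, 4 * #|act1 g|%:R <= N.+1%:R * e ^+ 2.
  exists (Num.truncn (4 * #|act1 g|%:R / e ^+ 2)).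
  by rewrite -ler_pdivrMr ?exprn_gt0// ltW// truncnS_gt.
exists N, ss => s.
(* The choice of [N] makes the square root of the potential at most
   [N.+1 * e * mass y]. *)
have rg_le y i : rg N.+1 y i <= N.+1%:R * (e * mass y).
  have m0 : 0 <= mass y by exact: le_trans (q_norm_le (br s) y i).
  have := @regret_bound R (act1 g) (mass y) (fun n => q (br (ss n)) y)
     (fun n => ss n y) (fun n => q_norm_le (br (ss n)) y).
  move=> /= /(_ _ N.+1) /=.
  have match0 n (b : act1 g -> R) : \sum_i0 Num.max 0
      (\sum_(l < n) (q (br (ss l)) y i0 - \sum_j ss l y j * q (br (ss l)) y j)) *
      (b i0 - \sum_j ss n y j * b j) = 0.
    by under eq_bigr do rewrite -rgE; exact: mtP.
  move=> /(_ match0); under eq_bigr do rewrite -rgE.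
  rewrite (bigD1 i)//= => h.
  have {h} : Num.max 0 (rg N.+1 y i) ^+ 2 <= (N.+1%:R * (e * mass y)) ^+ 2.
    have rest0 : 0 <= \sum_(j | j != i) Num.max 0 (rg N.+1 y j) ^+ 2.
      by apply: sumr_ge0 => j _; exact: sqr_ge0.
    apply: le_trans (le_trans _ h) _; first by rewrite lerDl.
    have -> : N.+1%:R * (#|act1 g|%:R * (2 * mass y) ^+ 2) =
      (4 * #|act1 g|%:R) * (N.+1%:R * mass y ^+ 2) by ring.
    have -> : (N.+1%:R * (e * mass y)) ^+ 2 =
      (N.+1%:R * e ^+ 2) * (N.+1%:R * mass y ^+ 2) by ring.
    by rewrite ler_wpM2r// mulr_ge0 ?ler0n ?sqr_ge0.
  rewrite ler_sqr ?nnegrE ?le_max ?lexx ?mulr_ge0 ?ler0n ?(ltW e0)//.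
  by rewrite ge_max => /andP[].
(* It remains to add up the bounds [rg_le] over the signals, which is the tower
   rule applied to a single expectation of the total difference. *)
rewrite -subr_le0 opprD addrA -sumrB.
pose stage s' t (w : K * S1 * S2) := \sum_i s' w.1.2 i * reply t w i.
have bstage s' t : bdd (stage s' t) := stage_bdd s' t.
have -> : \sum_(n < N.+1) (expected_payoff u s (br (ss n)) -
     expected_payoff u (ss n) (br (ss n))) - N.+1%:R * e =
   expect u (fun w => \sum_(n < N.+1) (stage s (br (ss n)) w -
      stage (ss n) (br (ss n)) w) - N.+1%:R * e).
  rewrite expectB ?expect_cst//; last 2 first.
  - by apply: bdd_sum => n _; exact: bddB.
  - exact: bdd_cst.
  rewrite expect_sum; last by move=> n _; exact: bddB.
  congr (_ - _); apply: eq_bigr => n _.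
  by rewrite expectB// !expected_payoffE.
apply: (@tower_le0 R _ u _ (fun w => w.1.2)) => [|y].
  by apply: bddB; [apply: bdd_sum => n _; exact: bddB|exact: bdd_cst].
have bb (b : K * S1 * S2 -> bool) := bdd_bool R b.
have stage_q s' t : expect u (fun w => (w.1.2 == y)%:R * stage s' t w) =
    \sum_i s' y i * q t y i.
  have breply i : bdd (fun w => (w.1.2 == y)%:R * reply t w i).
    by apply: bddM => //; exists 1 => w; exact: reply_norm_le.
  rewrite /q; under [RHS]eq_bigr do rewrite -expectZ//.
  rewrite -expect_sum; last first.
    by move=> i _; apply: bddM => //; exact: bdd_cst.
  congr expect; apply/funext => w; rewrite mulr_sumr; apply: eq_bigr => i _.
  by have [->|_] := eqVneq w.1.2 y; rewrite ?mul0r ?mulr0 ?mul1r.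
under eq_fun do rewrite mulrBr mulr_sumr.
under eq_fun => w do under eq_bigr do rewrite mulrBr.
have bst n s' : bdd (fun w => (w.1.2 == y)%:R * stage s' (br (ss n)) w).
  by apply: bddM.
rewrite expectB; last 2 first.
- by apply: bdd_sum => n _; exact: bddB.
- by apply: bddM => //; exact: bdd_cst.
rewrite expect_sum; last by move=> n _; exact: bddB.
under eq_bigr do rewrite expectB// !stage_q.
under [X in _ - expect u X]eq_fun do rewrite mulrC.
rewrite expectZ// -/(mass y) subr_le0.
have -> : \sum_(n < N.+1) (\sum_i s y i * q (br (ss n)) y i -
     \sum_i ss n y i * q (br (ss n)) y i) = \sum_i s y i * rg N.+1 y i.
  under [RHS]eq_bigr do rewrite rgE mulr_sumr.
  rewrite exchange_big; apply: eq_bigr => n _ /=.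
  under [RHS]eq_bigr do rewrite mulrBr.
  by rewrite sumrB -mulr_suml dist_sum mul1r.
by rewrite -mulrA; apply: dist_avg_le => i.
Qed.

Let payoffs1 s := [set expected_payoff u s t | t in [set: strategy2 S2 g]].
Let payoffs2 t := [set expected_payoff u s t | s in [set: strategy1 S1 g]].

Let payoffs1_nonempty s : payoffs1 s !=set0.
Proof.
by have [t _] := strategy2_inhabited; exists (expected_payoff u s t), t.
Qed.

Let payoffs2_nonempty t : payoffs2 t !=set0.
Proof.
by have [s _] := strategy1_inhabited; exists (expected_payoff u s t), s.
Qed.

Let payoffs1_lb s : has_lbound (payoffs1 s).
Proof.
exists (-1) => _ [t _ <-].
by have := payoff_norm_le s t; rewrite ler_norml => /andP[].
Qed.

Let payoffs2_ub t : has_ubound (payoffs2 t).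
Proof.
exists 1 => _ [s _ <-].
by have := payoff_norm_le s t; rewrite ler_norml => /andP[].
Qed.

Let maxmin_set := [set inf (payoffs1 s) | s in [set: strategy1 S1 g]].
Let minmax_set := [set sup (payoffs2 t) | t in [set: strategy2 S2 g]].

Let inf_le_payoff s t : inf (payoffs1 s) <= expected_payoff u s t.
Proof. by apply: ge_inf => //; exists t. Qed.

Let payoff_le_sup s t : expected_payoff u s t <= sup (payoffs2 t).
Proof. by apply: ub_le_sup => //; exists s. Qed.

Let maxmin_set_ub : has_ubound maxmin_set.
Proof.
have [t _] := strategy2_inhabited; exists 1 => _ [s _ <-].
apply: le_trans (inf_le_payoff s t) _.
by have := payoff_norm_le s t; rewrite ler_norml => /andP[].
Qed.

Let maxmin_set_nonempty : maxmin_set !=set0.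
Proof. by have [s _] := strategy1_inhabited; exists (inf (payoffs1 s)), s. Qed.

Let minmax_set_lb : has_lbound minmax_set.
Proof.
have [s _] := strategy1_inhabited; exists (-1) => _ [t _ <-].
apply: le_trans (payoff_le_sup s t).
by have := payoff_norm_le s t; rewrite ler_norml => /andP[].
Qed.

Let minmax_set_nonempty : minmax_set !=set0.
Proof. by have [t _] := strategy2_inhabited; exists (sup (payoffs2 t)), t. Qed.

Lemma maxmin_ge s c : (forall t, c <= expected_payoff u s t) -> c <= maxmin u g.
Proof.
move=> h; apply: (@le_trans _ _ (inf (payoffs1 s))).
  by apply: lb_le_inf => // _ [t _ <-].
by apply: ub_le_sup => //; exists s.
Qed.

Lemma minmax_le t c : (forall s, expected_payoff u s t <= c) -> minmax u g <= c.
Proof.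
move=> h; apply: (@le_trans _ _ (sup (payoffs2 t))).
  by apply: ge_inf => //; exists t.
by apply: ge_sup => // _ [s _ <-].
Qed.

Lemma maxmin_adherent e : 0 < e ->
  exists s, forall t, maxmin u g - e <= expected_payoff u s t.
Proof.
move=> e0; have [|_ [s _ <-] h] := @sup_adherent R maxmin_set e e0.
  by split.
by exists s => t; apply: ltW; exact: lt_le_trans h (inf_le_payoff s t).
Qed.

Lemma best_reply e s : 0 < e ->
  exists t, expected_payoff u s t <= maxmin u g + e.
Proof.
move=> e0; have [|_ [t _ <-] h] := @inf_adherent R (payoffs1 s) e e0.
  by split.
exists t; apply: (le_trans (ltW h)); rewrite lerD2r.
by apply: ub_le_sup => //; exists s.
Qed.

Lemma maxmin_le_minmax : maxmin u g <= minmax u g.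
Proof.
apply: ge_sup => // _ [s _ <-]; apply: lb_le_inf => // _ [t _ <-].
exact: le_trans (inf_le_payoff s t) (payoff_le_sup s t).
Qed.

(** If player 2 answers [ss n] by an [e]-best reply, the average of these replies
concedes at most [maxmin + e] plus the average regret of player 1. *)
Lemma minimax : maxmin u g = minmax u g.
Proof.
apply/eqP; rewrite eq_le maxmin_le_minmax /=; apply/ler_addgt0Pl => e e0.
have e20 : 0 < e / 2 by rewrite divr_gt0.
have /choice[br brP] s := best_reply s e20.
have [N [ss ssP]] := no_regret br e20.
have [t tE] := avg_strategy2 N (fun n => br (ss n)).
apply: (@minmax_le t) => s; rewrite tE.
rewrite ler_pdivrMl ?ltr0n//; apply: le_trans (ssP s) _.
have -> : N.+1%:R * (e + maxmin u g) =
  N.+1%:R * (maxmin u g + e / 2) + N.+1%:R * (e / 2) by field.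
rewrite lerD2r mulr_natl -[X in _ *+ X](card_ord N.+1) -sumr_const.
by apply: ler_sum => n _; exact: brP.
Qed.

Lemma game_valueE : game_value u g = maxmin u g.
Proof.
rewrite /game_value.
have [|-> //] := @xgetPex R 0 [set w | w = maxmin u g /\ w = minmax u g].
by exists (maxmin u g); split; rewrite // minimax.
Qed.

Lemma game_value_norm_le : `|game_value u g| <= 1.
Proof.
rewrite game_valueE ler_norml; apply/andP; split.
  have [s _] := strategy1_inhabited; apply: (@maxmin_ge s) => t.
  by have := payoff_norm_le s t; rewrite ler_norml => /andP[].
have [t _] := strategy2_inhabited; rewrite minimax; apply: (@minmax_le t) => s.
by have := payoff_norm_le s t; rewrite ler_norml => /andP[].
Qed.

End Minimax.

Section Comparison.
Set Implicit Arguments.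
Unset Strict Implicit.
Variable R : realType.

(** As the value is [maxmin], it is enough to transport player 1's strategies
from one game to the other and player 2's strategies backwards. *)
Lemma game_value_le (K K' : finType) (S1 S2 T1 T2 : countType)
    (u : dist R (K * S1 * S2)%type) (g : payoff R K)
    (v : dist R (K' * T1 * T2)%type) (h : payoff R K') (c : R) :
  (forall s : strategy1 S1 g, exists s' : strategy1 T1 h,
     forall t' : strategy2 T2 h, exists t : strategy2 S2 g,
     expected_payoff u s t <= expected_payoff v s' t' + c) ->
  game_value u g <= game_value v h + c.
Proof.
move=> H; rewrite !game_valueE; apply/ler_addgt0Pr => e e0.
have [s sP] := maxmin_adherent u g e0.
have [s' s'P] := H s.
rewrite -lerBlDr -lerBlDr; apply: (@maxmin_ge R K' T1 T2 v h s') => t'.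
have [t tP] := s'P t'.
by rewrite lerBlDr (le_trans _ tP).
Qed.

End Comparison.

(** * Replacing a signal by a plan *)

Section Plans.
Set Implicit Arguments.
Unset Strict Implicit.
Variables (R : realType) (B I : finType).

(** The condition on the coordinate [b0] is absorbed in the factor of index [b0],
and the sum of products is a product of sums. *)
Lemma product_marginal (p : B -> I -> R) (b0 : B) (i0 : I) :
  (forall b, \sum_i p b i = 1) ->
  \sum_(a : {ffun B -> I} | a b0 == i0) \prod_b p b (a b) = p b0 i0.
Proof.
move=> p1; rewrite big_mkcond /=.
pose p' b i := if b == b0 then p b i * (i == i0)%:R else p b i.
transitivity (\sum_(a : {ffun B -> I}) \prod_b p' b (a b)).
  apply: eq_bigr => a _; rewrite (bigD1 b0)//= [RHS](bigD1 b0)//= {1}/p' eqxx.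
  have -> : \prod_(b | b != b0) p' b (a b) = \prod_(b | b != b0) p b (a b).
    by apply: eq_bigr => b /negPf bb0; rewrite /p' bb0.
  by case: ifP => _; rewrite ?mulr1// mulr0 mul0r.
rewrite -(bigA_distr_bigA p') (bigD1 b0)//= [X in _ * X]big1 => [|b /negPf bb0].
  rewrite mulr1 (bigD1 i0)//= /p' !eqxx mulr1 big1 ?addr0// => i /negPf ->.
  by rewrite mulr0.
by rewrite -[RHS](p1 b); apply: eq_bigr => i _; rewrite /p' bb0.
Qed.

Lemma product_dist (p : B -> dist R I) :
  exists q : dist R {ffun B -> I}, forall b i,
    \sum_(a : {ffun B -> I} | a b == i) q a = p b i.
Proof.
have [a||q qE] := @finite_dist R _ (fun a : {ffun B -> I} => \prod_b p b (a b)).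
- by apply: prodr_ge0 => b _; exact: Defs.pmf_ge0.
- rewrite -(bigA_distr_bigA (fun b i => p b i)).
  by apply: big1 => b _; exact: dist_sum.
exists q => b i; under eq_bigr do rewrite qE.
by rewrite (product_marginal (p := fun b i => p b i))// => b'; exact: dist_sum.
Qed.

Lemma ffun_marginal_dist (q : dist R {ffun B -> I}) (b : B) :
  exists p : dist R I, forall i,
    \sum_(a : {ffun B -> I} | a b == i) q a = p i.
Proof.
have [i||p pE] := @finite_dist R I
    (fun i => \sum_(a : {ffun B -> I} | a b == i) q a).
- by apply: sumr_ge0 => a _; exact: Defs.pmf_ge0.
- rewrite -[RHS](dist_sum q).
  by rewrite (partition_big (fun a : {ffun B -> I} => a b) xpredT).
by exists p => i; rewrite pE.
Qed.

Lemma ffun_marginal_avg (q : {ffun B -> I} -> R) (p : I -> R) (b : B)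
    (h : I -> R) :
  (forall i, \sum_(a : {ffun B -> I} | a b == i) q a = p i) ->
  \sum_a q a * h (a b) = \sum_i p i * h i.
Proof.
move=> qp; rewrite (partition_big (fun a : {ffun B -> I} => a b) xpredT)//=.
apply: eq_bigr => i _; rewrite -qp mulr_suml.
by apply: eq_bigr => a /eqP ->.
Qed.

End Plans.

Section Reduction.
Set Implicit Arguments.
Unset Strict Implicit.
Variables (R : realType) (K : finType) (A : countType).
Variables (kern : K -> A -> R).
Hypothesis kern_ge0 : forall k a, 0 <= kern k a.
Hypothesis kern_le1 : forall k (r : seq A), uniq r ->
  \sum_(a <- r) kern k a <= 1.
Variables (g : payoff R K) (F : seq A).

Lemma big_seq_sub (G : A -> R) :
  \sum_(b : seq_sub F) G (val b) = \sum_(a <- undup F) G a.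
Proof.
rewrite -(big_map val xpredT G); apply: perm_big; apply: uniq_perm.
- by rewrite map_inj_uniq ?index_enum_uniq//; exact: val_inj.
- exact: undup_uniq.
- move=> a; rewrite mem_undup; apply/mapP/idP => [[b _ ->]|aF].
    exact: valP.
  by exists (SeqSub aF).
Qed.

(* Plans are only defined on [F]; the payoff ignores the mass that [kern]
   puts outside [F], so [kern k] may be a sub-probability. *)
Let plan := {ffun seq_sub F -> act1 g}.

Let plan_pay (k : K) (a : plan) (j : act2 g) : R :=
  \sum_(b : seq_sub F) kern k (val b) * g k (a b) j.

Let plan_gt0 : (0 < #|plan|)%N.
Proof.
have /card_gt0P[i _] := act1_gt0 g.
by apply/card_gt0P; exists [ffun=> i].
Qed.

Let plan_pay_bounded k a j : -1 <= plan_pay k a j <= 1.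
Proof.
rewrite -ler_norml (le_trans (ler_norm_sum _ _ _))//.
apply: le_trans (kern_le1 k (undup_uniq F)).
rewrite -big_seq_sub; apply: ler_sum => b _.
by rewrite normrM ger0_norm// ler_piMr// pay_norm_le.
Qed.

Definition plan_game : payoff R K :=
  Payoff plan_gt0 (act2_gt0 g) plan_pay_bounded.

(* [P] is a common law from which both games are drawn: player 1 observes
   [pair x c] under [v] and only [x] under [w].  This setting covers both
   comparisons of the theorem, with [x] equal to [(c, c2)] or to [c]. *)
Variables (Omega X Y D : countType) (P : dist R Omega).
Variables (state : Omega -> K) (x : Omega -> X) (c : Omega -> A).
Variable (d : Omega -> D).
Variables (pair : X -> A -> Y) (fstp : Y -> X) (sndp : Y -> A).
Hypothesis fstpK : forall x0 a, fstp (pair x0 a) = x0.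
Hypothesis sndpK : forall x0 a, sndp (pair x0 a) = a.
Variables (v : dist R (K * Y * D)%type) (w : dist R (K * X * D)%type).
Hypothesis vE : forall h, bdd h ->
  expect v h = expect P (fun o => h (state o, pair (x o) (c o), d o)).
Hypothesis wE : forall h, bdd h ->
  expect w h = expect P (fun o => h (state o, x o, d o)).
Hypothesis c_indep : forall (a : A) (f : K -> X -> D -> R) ,
  (exists M : R, forall k x0 d0, `|f k x0 d0| <= M) ->
  expect P (fun o => (c o == a)%:R * f (state o) (x o) (d o)) =
  expect P (fun o => kern (state o) a * f (state o) (x o) (d o)).

Let tail : R := expect P (fun o => (c o \notin F)%:R).

(** The plan drawn by [s'] prescribes, at each [b] in [F], the same law of
actions as [s] after the signals [x0] and [b]. *)
Definition executes (s' : strategy1 X plan_game) (s : strategy1 Y g) :=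
  forall x0 (b : seq_sub F) i,
    \sum_(a : plan | a b == i) s' x0 a = s (pair x0 (val b)) i.

Lemma plan_of_strategy (s : strategy1 Y g) : exists s', executes s' s.
Proof.
have /choice[s' s'P] (x0 : X) :=
  product_dist (fun b : seq_sub F => s (pair x0 (val b))).
by exists s'.
Qed.

(** On signals outside [F], where the plan says nothing, any action will do. *)
Lemma strategy_of_plan (s' : strategy1 X plan_game) : exists s, executes s' s.
Proof.
have /choice[s sP] (y : Y) : exists p : dist R (act1 g),
    forall b : seq_sub F, val b = sndp y ->
    forall i, \sum_(a : plan | a b == i) s' (fstp y) a = p i.
  have [yF|yF] := boolP (sndp y \in F).
    have [p pP] := ffun_marginal_dist (s' (fstp y)) (SeqSub yF).
    exists p => b bE i; rewrite -pP.
    by have -> : b = SeqSub yF by exact: val_inj.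
  have /card_gt0P[i _] := act1_gt0 g.
  have [p _] := dirac_dist R i; exists p => b bE.
  by rewrite -bE (valP b) in yF.
by exists s => x0 b i; rewrite -(sP _ b) ?sndpK// fstpK.
Qed.

(** Independence of [c] given the state turns an average over the realized [c]
into the average that defines the payoff of a plan; only [c] outside [F] is lost. *)
Lemma executes_payoff (s' : strategy1 X plan_game) (s : strategy1 Y g)
    (t : strategy2 D g) : executes s' s ->
  `|expected_payoff v s t - @expected_payoff R K X D w plan_game s' t| <= tail.
Proof.
move=> ss'.
pose H k d0 i : R := \sum_j t d0 j * g k i j.
pose G k x0 a d0 : R := \sum_i s (pair x0 a) i * H k d0 i.
have G1 k x0 a d0 : `|G k x0 a d0| <= 1.
  apply: dist_avg_norm_le => i; apply: dist_avg_norm_le => j.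
  exact: pay_norm_le.
rewrite !expected_payoffE vE; last exact: stage_bdd.
rewrite wE; last exact: (@stage_bdd R K X D plan_game s' t).
have bkern (a : A) : bdd (fun o => kern (state o) a).
  exists 1 => o; rewrite ger0_norm//.
  by have := @kern_le1 (state o) [:: a] isT; rewrite big_seq1.
have bG a : bdd (fun o => G (state o) (x o) a (d o)) by exists 1.
have -> : (fun o => \sum_(a : act1 plan_game) s' (state o, x o, d o).1.2 a *
      @reply R K X D plan_game t (state o, x o, d o) a) =
    (fun o => \sum_(b : seq_sub F)
      kern (state o) (val b) * G (state o) (x o) (val b) (d o)).
  apply/funext => o; rewrite /reply /=.
  under [RHS]eq_bigr => b _ do
    rewrite /G -(ffun_marginal_avg _ (fun i => ss' (x o) b i)) mulr_sumr.
  rewrite [RHS]exchange_big; apply: eq_bigr => a _ /=.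
  under [RHS]eq_bigr do rewrite mulrCA; rewrite -mulr_sumr; congr (_ * _).
  rewrite /H; under [RHS]eq_bigr do rewrite mulr_sumr.
  rewrite [RHS]exchange_big; apply: eq_bigr => j _ /=.
  by rewrite mulr_sumr; apply: eq_bigr => b _; rewrite mulrCA.
rewrite [X in _ - X]expect_sum; last first.
  by move=> b _; apply: bddM; [exact: bkern|exact: bG].
have -> : \sum_(b : seq_sub F) expect P (fun o =>
      kern (state o) (val b) * G (state o) (x o) (val b) (d o)) =
    \sum_(a <- undup F) expect P (fun o => (c o == a)%:R *
      \sum_i s (pair (x o) (c o)) i * H (state o) (d o) i).
  rewrite -big_seq_sub; apply: eq_bigr => b _.
  rewrite -(@c_indep (val b) (fun k x0 d0 => G k x0 (val b) d0)).
    2: by exists 1.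
  congr expect; apply/funext => o.
  by have [->|_] := eqVneq (c o) (val b); rewrite ?mul0r.
rewrite -[leRHS]mul1r.
apply: (expect_truncate P c F (f := fun o => G (state o) (x o) (c o) (d o))) => o.
exact: G1.
Qed.

(** Player 2 uses the same strategies in both games, so the payoff comparison
passes to the values. *)
Lemma plan_game_value : `|game_value v g - game_value w plan_game| <= tail.
Proof.
rewrite ler_norml; apply/andP; split.
  rewrite lerBrDr addrC lerBlDr; apply: game_value_le => s.
  have [s' ss'] := strategy_of_plan s; exists s' => t; exists t.
  have := executes_payoff t ss'; rewrite distrC => /(le_trans (ler_norm _)).
  by rewrite lerBlDr addrC.
rewrite lerBlDr addrC; apply: game_value_le => s.
have [s' ss'] := plan_of_strategy s; exists s' => t; exists t.
have := executes_payoff t ss' => /(le_trans (ler_norm _)).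
by rewrite lerBlDr addrC.
Qed.

End Reduction.

(** * Conditional independence and the comparison of distances *)

Section ConditionalLaw.
Set Implicit Arguments.
Unset Strict Implicit.
Variables (R : realType) (T K A B : countType) (u : dist R T).
Variables (state : T -> K) (c : T -> A) (x : T -> B).

Lemma Pr_ge0 (E : set T) : 0 <= Pr u E.
Proof. by apply/fine_ge0/esum_ge0 => o _; rewrite lee_fin Defs.pmf_ge0. Qed.

Lemma Pr_asbool (E : set T) : Pr u E = expect u (fun o => `[< E o >]%:R).
Proof. by apply: Pr_expect => o; split => /asboolP. Qed.

Lemma le_Pr (E G : set T) : E `<=` G -> Pr u E <= Pr u G.
Proof.
move=> EG; rewrite !Pr_asbool; apply: le_expect => [||o]; try exact: bdd_bool.
by rewrite ler_nat; case: asboolP => // /EG Go; rewrite asboolT.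
Qed.

(** The conditional law of [c] given the state; it is zero, hence not a law, on
states of probability zero. *)
Definition cond_law (k : K) (a : A) : R :=
  cPr u (c @^-1` [set a]) (state @^-1` [set k]).

Lemma cond_law_ge0 k a : 0 <= cond_law k a.
Proof. by rewrite divr_ge0// Pr_ge0. Qed.

Lemma cond_law_le1 k (r : seq A) : uniq r -> \sum_(a <- r) cond_law k a <= 1.
Proof.
move=> ur; rewrite -mulr_suml.
have [P0|P0] := eqVneq (Pr u (state @^-1` [set k])) 0.
  by rewrite P0 invr0 mulr0 ler01.
rewrite ler_pdivrMr ?lt_def ?P0 ?Pr_ge0// mul1r.
under eq_bigr do rewrite Pr_asbool.
rewrite Pr_asbool -expect_sum; last by move=> a _; exact: bdd_bool.
apply: le_expect => [||o]; [|exact: bdd_bool|].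
  by apply: bdd_sum => a _; exact: bdd_bool.
have [cr|cr] := boolP (c o \in r).
  rewrite (bigD1_seq (c o))//= big1 ?addr0 => [|a ac].
    by rewrite ler_nat; case: asboolP => // -[_ ?]; rewrite asboolT.
  by rewrite asboolF//= => -[/= ca _]; rewrite -ca eqxx in ac.
rewrite big1_seq ?ler0n// => a /= ar.
by rewrite asboolF//= => -[/= ca _]; rewrite ca ar in cr.
Qed.

(** By the tower rule it is enough to fix the state and [x], where the claim is
the product formula multiplied by the probability of the state; a state of
probability zero contributes nothing to either side. *)
Lemma cond_indep_expect (a : A) (f : K -> B -> R) :
  cond_indep u c x state ->
  (exists M : R, forall k b, `|f k b| <= M) ->
  expect u (fun o => (c o == a)%:R * f (state o) (x o)) =
  expect u (fun o => cond_law (state o) a * f (state o) (x o)).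
Proof.
move=> indep [M fM].
have bker : bdd (fun o => cond_law (state o) a).
  exists 1 => o; rewrite ger0_norm ?cond_law_ge0//.
  by have := @cond_law_le1 (state o) [:: a] isT; rewrite big_seq1.
have bf : bdd (fun o => f (state o) (x o)) by exists M.
have bb (b : T -> bool) := bdd_bool R b.
have bcf : bdd (fun o => (c o == a)%:R * f (state o) (x o)) by exact: bddM.
have bkf : bdd (fun o => cond_law (state o) a * f (state o) (x o)).
  exact: bddM.
apply/eqP; rewrite -subr_eq0 -expectB//; apply/eqP.
apply: (@tower_eq0 R T u _ (fun o => (state o, x o))) => [|[k b]].
  exact: bddB.
pose E := state @^-1` [set k].
pose X := x @^-1` [set b].
pose C := c @^-1` [set a].
have -> : (fun o => ((state o, x o) == (k, b))%:R *
      ((c o == a)%:R * f (state o) (x o) -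
       cond_law (state o) a * f (state o) (x o))) =
   (fun o => f k b * (`[< ((C `&` X) `&` E) o >]%:R -
       cond_law k a * `[< (X `&` E) o >]%:R)).
  apply/funext => o.
  have [[sk xb]|ne] := eqVneq (state o, x o) (k, b); last first.
    rewrite mul0r !asboolF; first by rewrite !mulr0 subr0 mulr0.
      by move=> [/= xb sk]; rewrite xb sk eqxx in ne.
    by move=> [[_ /= xb] sk]; rewrite xb sk eqxx in ne.
  have -> : `[< (X `&` E) o >] by exact/asboolP.
  have -> : `[< ((C `&` X) `&` E) o >] = (c o == a).
    by apply/asboolP/eqP => [[[]]|].
  by rewrite sk xb mul1r mulr1; ring.
rewrite expectZ; last by apply: bddB => //; apply: bddM => //; exact: bdd_cst.
rewrite expectB//; last by apply: bddM => //; exact: bdd_cst.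
rewrite expectZ// -!Pr_asbool.
suff -> : Pr u (C `&` X `&` E) = cond_law k a * Pr u (X `&` E).
  by rewrite subrr mulr0.
have [E0|E0] := eqVneq (Pr u E) 0.
  have null G : G `<=` E -> Pr u G = 0.
    by move=> /le_Pr; rewrite E0 => G0; apply/eqP; rewrite eq_le G0 Pr_ge0.
  by rewrite !null ?mulr0// => o [].
have := indep k; rewrite lt_def E0 Pr_ge0 => /(_ isT a b).
rewrite -/(cond_law k a) /cPr -/E -/X -/C.
move=> /(congr1 (fun r => r * Pr u E)).
by rewrite divfK// -mulrA divfK.
Qed.

End ConditionalLaw.

Section BoundedDistance.
Set Implicit Arguments.
Unset Strict Implicit.
Variables (R : realType) (K : finType) (S1 S2 T1 T2 : countType).
Variables (u : dist R (K * S1 * S2)%type) (v : dist R (K * T1 * T2)%type).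

Lemma value_gap_le_vdist (g : payoff R K) :
  `|game_value u g - game_value v g| <= vdist u v.
Proof.
apply: ub_le_sup; last by exists g.
exists 2 => _ [h ->]; rewrite (le_trans (ler_normB _ _))//.
by rewrite (_ : 2 = 1 + 1)// lerD// game_value_norm_le.
Qed.

(** The null game is a witness that the set of value gaps is nonempty, as
otherwise its supremum would be a default. *)
Lemma vdist_le (c : R) :
  (forall g : payoff R K, `|game_value u g - game_value v g| <= c) ->
  vdist u v <= c.
Proof.
move=> h; apply: ge_sup; last by move=> _ [g ->].
have unit_gt0 : (0 < #|{: unit}|)%N by rewrite card_unit.
have zero_bounded (k : K) (i j : unit) : -1 <= (0 : R) <= 1.
  by rewrite ler01 lerN10.
pose g0 := Payoff unit_gt0 unit_gt0 zero_bounded.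
by exists `|game_value u g0 - game_value v g0|, g0.
Qed.

End BoundedDistance.

Theorem proposition9 (R : realType) (K : finType) (K_ge2 : (2 <= #|K|)%N)
    (C C1 C2 D : countType)
    (u : dist R (K * (C * C1 * C2) * D)%type)
    (v : dist R (K * (C * C1) * D)%type)
    (u' : dist R (K * (C * C2) * D)%type)
    (v' : dist R (K * C * D)%type)
    (v_def : v = marg (fun '(k, (c, c1, c2), d) => (k, (c, c1), d)) u)
    (u'_def : u' = marg (fun '(k, (c, c1, c2), d) => (k, (c, c2), d)) u)
    (v'_def : v' = marg (fun '(k, (c, c1, c2), d) => (k, c, d)) u)
    (c1_indep : cond_indep u (fun '(k, (c, c1, c2), d) => c1)
                             (fun '(k, (c, c1, c2), d) => (c, c2, d))
                             (fun '(k, (c, c1, c2), d) => k)) :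
  vdist u' v' >= vdist u v.
Proof.
set c1 := (fun o => let '(_, (_, c1, _), _) := o in c1) in c1_indep.
set xd := (fun o => let '(_, (c, _, c2), d) := o in (c, c2, d)) in c1_indep.
set k := (fun o => let '(k, _, _) := o in _) in c1_indep.
apply: vdist_le => g; apply/ler_addgt0Pr => e e0.
have e20 : 0 < e / 2 by rewrite divr_gt0.
(* One finite set [F], hence one game [g'], serves both comparisons. *)
have [F tailF] := expect_tail u c1 e20.
pose g' := plan_game (cond_law_ge0 u k c1) (@cond_law_le1 _ _ _ _ u k c1) g F.
pose cc2 o := (xd o).1.
pose cc o := (cc2 o).1.
pose dd o := (xd o).2.
have indep_u (a : C1) (f : K -> C * C2 -> D -> R) :
    (exists M : R, forall k x d, `|f k x d| <= M) ->
    expect u (fun o => (c1 o == a)%:R * f (k o) (cc2 o) (dd o)) =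
    expect u (fun o => cond_law u k c1 (k o) a * f (k o) (cc2 o) (dd o)).
  move=> [M fM].
  apply: (cond_indep_expect a (f := fun k y => f k y.1 y.2) c1_indep).
  by exists M => k0 [].
have red_u : `|game_value u g - game_value u' g'| <= e / 2.
  apply: le_trans tailF.
  apply: (@plan_game_value _ _ _ _ _ _ _ _ _ _ _ _ u k cc2 c1 dd
    (fun x a => (x.1, a, x.2)) (fun y => (y.1.1, y.2)) (fun y => y.1.2)) => //.
  - by move=> [].
  - by move=> h _; congr expect; apply/funext => -[[? [[? ?] ?]] ?].
  - move=> h bh; rewrite u'_def expect_marg//.
    by congr expect; apply/funext => -[[? [[? ?] ?]] ?].
have red_v : `|game_value v g - game_value v' g'| <= e / 2.
  apply: le_trans tailF.
  apply: (@plan_game_value _ _ _ _ _ _ _ _ _ _ _ _ u k cc c1 dd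
    pair fst snd) => //.
  - move=> h bh; rewrite v_def expect_marg//.
    by congr expect; apply/funext => -[[? [[? ?] ?]] ?].
  - move=> h bh; rewrite v'_def expect_marg//.
    by congr expect; apply/funext => -[[? [[? ?] ?]] ?].
  - move=> a f [M fM].
    by rewrite (indep_u a (fun k x d => f k x.1 d))//; exists M.
have := value_gap_le_vdist u' v' g'.
move: red_u red_v; rewrite !ler_norml => /andP[? ?] /andP[? ?] /andP[? ?].
by apply/andP; split; lra.
Qed.
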